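(* Let $q=2^h$, $h\geq4$. Let $\alpha_{1},\alpha_{2},\alpha_{3}\in\mathbb{F}^{*}_{q}$ be $\mathbb{F}_{2}$-independent and define $S=\{x\in\mathbb{F}_{q}\mid \mathrm{Tr}(\alpha_{i}x)=0 \text{ for } i=1,2,3\}$. Let $\beta_{1},\beta_{2},\beta_{3}\in\mathbb{F}^{*}_{q}$ be such that $\mathrm{Tr}(\alpha_{i}\beta_{j})=\delta_{i,j}$ for all $i,j\in\{1,2,3\}$. Let $f_{1},f_{2},f_{3}:\mathbb{F}_2^3\to\mathbb{F}_2$ be given by $f_{1}(x,y,z)= x+y+z+yz$, $f_{2}(x,y,z)= y+z+xz$ and $f_{3}(x,y,z)= z+xy$. For any $\lambda=(\lambda_{1},\lambda_{2},\lambda_{3})\in\mathbb{F}^{3}_{2}$ define $$\mathcal{S}_{\lambda}=\left\{\left(1,\sum^{3}_{i=1}\lambda_{i}\alpha_{i},\sum^{3}_{i=1}f_{i}(\lambda_{1},\lambda_{2},\lambda_{3})\beta_{i}+s\right)\Big|\ s\in S\right\},$$ define $\mathcal{S}_{0}=\{(0,1,x)\mid x\in\mathbb{F}_q,\ \mathrm{Tr}(\alpha^{2}_{i}x)=0\text{ for } i=1,2,3\}$ (a set distinct from the one indexed by the zero vector of $\mathbb{F}_2^3$), and let $\mathcal{A}=\mathcal{S}_{0}\cup\bigcup_{\lambda\in\mathbb{F}^{3}_{2}}\mathcal{S}_{\lambda}$. If $q>16$, then $\mathcal{A}$ is an elation KM-arc of type $q/8$ in $\mathrm{PG}(2,q)$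 with elation line $X=0$ and $q/8$-nucleus $(0,0,1)$. If $q=16$, then $\mathcal{A}$ is an elation hyperoval in $\mathrm{PG}(2,q)$ with elation line $X=0$.
   Context: $\mathrm{Tr}$ is the absolute trace $\mathbb{F}_q\to\mathbb{F}_2$; $\delta_{i,j}$ is the Kronecker delta. Points of $\mathrm{PG}(2,q)$ have homogeneous coordinates $(X,Y,Z)$. A KM-arc of type $t$ in $\mathrm{PG}(2,q)$ is a set of $q+t$ points such that every line meets it in $0$, $2$ or $t$ points (each value occurring); a line meeting it in $i$ points is an $i$-secant. A hyperoval is a KM-arc of type $2$. If $t>2$, all $t$-secants pass through one common point, the $t$-nucleus. An elation with axis a line $\ell$ and centre a point $R\in\ell$ is a collineation fixing all points of $\ell$ and stabilising all lines through $R$. A KM-arc $\mathcal{A}$ of type $t>2$ is an elation KM-arc with elation line $\ell_\infty$ if for every $t$-secant $\ell\neq\ell_\infty$ the group of elations with axis $\ell_\infty$ stabilising $\mathcal{A}$ is transitive on the points of $\mathcal{A}\cap\ell$ (any point of $\mathcal{A}\cap\ell$ can be mapped to any other one by an element of the group). A hyperoval is an elation hyperoval with elation line $\ell_\infty$ if it is stabilised by a non-trivial elation with axis $\ell_\infty$. *)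

(* Defs.v *)
From HB Require Import structures.
From mathcomp Require Import all_boot all_order all_algebra all_fingroup all_field.

Set Implicit Arguments.
Unset Strict Implicit.
Unset Printing Implicit Defensive.

Import GRing.Theory.
Local Open Scope ring_scope.

(* vector.v leaves {vspace vT} a mere choiceType, even over a finite field. *)
Section FiniteVspace.

Variables (F : finFieldType) (vT : vectType F).

HB.instance Definition _ : isCountable {vspace vT} :=
  CanIsCountable (@VectorInternalTheory.vs2mxK F vT).
HB.instance Definition _ : isFinite {vspace vT} :=
  CanIsFinite (@VectorInternalTheory.vs2mxK F vT).

End FiniteVspace.

Section ProjectivePlane.

Variable F : finFieldType.

Definition point := {U : {vspace 'rV[F]_3} | \dim U == 1%N}.
Definition line := {U : {vspace 'rV[F]_3} | \dim U == 2%N}.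

Definition incident (P : point) (L : line) : bool := (val P <= val L)%VS.

Definition points_on (L : line) : {set point} := [set P | incident P L].

Definition vec3 (x y z : F) : 'rV[F]_3 := \row_(i < 3) [:: x; y; z]`_i.

Definition has_coords (P : point) (x y z : F) : bool :=
  val P == <[vec3 x y z]>%VS.

Lemma vec001_dim : \dim <[(vec3 0 0 1)%R]>%VS == 1%N.
Proof.
rewrite dim_vline eqb1; apply/eqP => /(congr1 (fun v : 'rV[F]_3 => v 0 2)) /eqP.
by rewrite !mxE /= oner_eq0.
Qed.

Definition point001 : point := exist _ <[(vec3 0 0 1)%R]>%VS vec001_dim.

Definition coordX : 'Hom('rV[F]_3, F^o) :=
  linfun (fun v : 'rV[F]_3 => v 0 0 : F^o).

Lemma coordXE (v : 'rV[F]_3) : coordX v = v 0 0.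
Proof.
have lin : linear (fun v : 'rV[F]_3 => v 0 0 : F^o).
  by move=> a u w; rewrite !mxE.
pose lL := GRing.isLinear.Build _ _ _ _ _ lin.
pose lf : {linear 'rV[F]_3 -> F^o} := HB.pack (fun v : 'rV[F]_3 => v 0 0 : F^o) lL.
exact: (lfunE lf v).
Qed.

Lemma dim_lker_coordX : \dim (lker coordX) == 2%N.
Proof.
have := limg_ker_dim coordX fullv; rewrite capfv dimvf /dim /= mul1n.
have -> : limg coordX = fullv.
  apply/eqP; rewrite eqEsubv subvf /=; apply/subvP => a _; apply/memv_imgP.
  by exists (vec3 a 0 0); rewrite ?memvf // coordXE mxE.
by rewrite dimvf /dim /= addn1 => -[->].
Qed.

Definition lineX0 : line := exist _ (lker coordX) dim_lker_coordX.

Definition secant (i : nat) (A : {set point}) (L : line) : bool :=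
  #|A :&: points_on L| == i.

Definition KM_arc (t : nat) (A : {set point}) : Prop :=
  [/\ #|A| = (#|F| + t)%N,
      forall L : line, [|| secant 0 A L, secant 2 A L | secant t A L]
    & [/\ exists L, secant 0 A L, exists L, secant 2 A L
        & exists L, secant t A L]].

Definition hyperoval (A : {set point}) : Prop := KM_arc 2 A.

Definition nucleus (t : nat) (A : {set point}) (N : point) : Prop :=
  forall P : point, (forall L, secant t A L -> incident P L) <-> P = N.

(* By finiteness, a permutation of the points that maps lines onto lines
   permutes the lines. *)
Definition collineation (g : {perm point}) : Prop :=
  forall L : line, exists M : line, g @: points_on L = points_on M.

(* The identity is an elation, with any centre on the axis. *)
Definition elation (L : line) (R : point) (g : {perm point}) : Prop :=
  [/\ collineation g, incident R L,
      forall P, incident P L -> g P = P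
    & forall M : line, incident R M -> g @: points_on M = points_on M].

Definition elation_with_axis (L : line) (g : {perm point}) : Prop :=
  exists R : point, elation L R g.

Definition stabilises (g : {perm point}) (A : {set point}) : Prop :=
  g @: A = A.

Definition elation_KM_arc (t : nat) (A : {set point}) (Linf : line) : Prop :=
  [/\ (2 < t)%N, KM_arc t A
    & forall L : line, secant t A L -> L != Linf ->
      forall P Q : point, P \in A :&: points_on L -> Q \in A :&: points_on L ->
      exists g, [/\ elation_with_axis Linf g, stabilises g A & g P = Q]].

Definition elation_hyperoval (A : {set point}) (Linf : line) : Prop :=
  hyperoval A /\
  exists g, [/\ elation_with_axis Linf g, g != 1%g & stabilises g A].

End ProjectivePlane.

Section Construction.

Variable F : finFieldType.

(* For #|F| = 2 ^ h this is the sum of the x ^ (2 ^ i) for i < h; the values lie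
   in the prime subfield {0, 1} of F, which stands for F_2. *)
Definition abs_trace (x : F) : F := \sum_(i < logn 2 #|F|) x ^+ (2 ^ i).

(* Intended for F of characteristic 2, where it embeds 'F_2 into F. *)
Definition F2_to (a : 'F_2) : F := (val a)%:R.

Definition F2_independent (v : 'I_3 -> F) : Prop :=
  forall c : 'I_3 -> 'F_2, \sum_i F2_to (c i) * v i = 0 -> forall i, c i = 0.

Definition f1 (x y z : 'F_2) : 'F_2 := x + y + z + y * z.
Definition f2 (x y z : 'F_2) : 'F_2 := y + z + x * z.
Definition f3 (x y z : 'F_2) : 'F_2 := z + x * y.

Definition f_ (i : 'I_3) : 'F_2 -> 'F_2 -> 'F_2 -> 'F_2 :=
  tnth [tuple f1; f2; f3] i.

Variables alpha beta : 'I_3 -> F.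

Definition set_S : {set F} := [set x | [forall i, abs_trace (alpha i * x) == 0]].

Definition S_lambda (lambda : {ffun 'I_3 -> 'F_2}) : {set point F} :=
  [set P | [exists s in set_S,
     has_coords P 1 (\sum_i F2_to (lambda i) * alpha i)
       (\sum_i F2_to (f_ i (lambda 0) (lambda 1) (lambda 2)) * beta i + s)]].

Definition S_0 : {set point F} :=
  [set P | [exists x : F,
     [forall i, abs_trace (alpha i ^+ 2 * x) == 0] && has_coords P 0 1 x]].

Definition arc_A : {set point F} :=
  S_0 :|: \bigcup_(lambda : {ffun 'I_3 -> 'F_2}) S_lambda lambda.

End Construction.

(* Main.v *)
(* Apart from X = 0, a line through (0,0,1) has an equation Y = cX and meets A in
   the set S_lambda with \sum_i lambda_i alpha_i = c, if there is one, and in the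
   empty set otherwise.  A line Z = mY + cX meets S_lambda (in one point) iff
   f(lambda) + M lambda + C = 0, where M_ij = Tr(alpha_i alpha_j m) and
   C_i = Tr(alpha_i c), and it meets S_0 iff the diagonal of the symmetric matrix
   M vanishes.  So the secant numbers reduce to a finite verification over F_2:
   f + M is a permutation of F_2^3 if M is alternating and is two-to-one onto its
   image otherwise.  The elations (X,Y,Z) |-> (X,Y,Z + sX) with s in S act
   transitively on each S_lambda. *)
From HB Require Import structures.
Require Import Defs.
From mathcomp Require Import all_boot all_order all_algebra all_fingroup all_field.
From mathcomp Require Import ring.

Set Implicit Arguments.
Unset Strict Implicit.
Unset Printing Implicit Defensive.

Import GRing.Theory.
Local Open Scope ring_scope.

(** * Points, lines and elations in coordinates *)

Section Plane.

Variable F : finFieldType.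
Implicit Types (x y z a b c m s : F) (P Q : point F) (L : line F).
Implicit Types u v n : 'rV[F]_3.

Lemma vec3E x y z :
  (vec3 x y z 0 0 = x) * (vec3 x y z 0 1 = y) * (vec3 x y z 0 2 = z).
Proof. by rewrite !mxE. Qed.

Lemma vec3_eta v : v = vec3 (v 0 0) (v 0 1) (v 0 2).
Proof.
apply/rowP => i; rewrite mxE.
by case: i => [[|[|[|]]]] //= lt_i; congr (v 0 _); apply: val_inj.
Qed.

Lemma scale_vec3 a x y z : a *: vec3 x y z = vec3 (a * x) (a * y) (a * z).
Proof. by apply/rowP => i; rewrite !mxE; case: i => [[|[|[|]]]]. Qed.

Lemma dim_vec3 {x y z} : (x != 0) || (y != 0) -> \dim <[vec3 x y z]>%VS == 1%N.
Proof.
move=> nz; rewrite dim_vline eqb1; apply/eqP => v0; case/orP: nz => /eqP[].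
  by have := congr1 (fun v : 'rV_3 => v 0 0) v0; rewrite vec3E mxE.
by have := congr1 (fun v : 'rV_3 => v 0 1) v0; rewrite vec3E mxE.
Qed.

Lemma dim_vec3_1 y z : \dim <[(vec3 1 y z)%R]>%VS == 1%N.
Proof. by rewrite dim_vec3 ?oner_neq0. Qed.

Lemma dim_vec3_01 z : \dim <[(vec3 0 1 z)%R]>%VS == 1%N.
Proof. by rewrite dim_vec3 ?oner_neq0 ?orbT. Qed.

Definition pt1 y z : point F :=
  exist _ <[(vec3 1 y z)%R]>%VS (dim_vec3_1 y z).
Definition pt0 z : point F :=
  exist _ <[(vec3 0 1 z)%R]>%VS (dim_vec3_01 z).

Lemma has_coords_pt1 P y z : has_coords P 1 y z = (P == pt1 y z).
Proof. by []. Qed.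

Lemma has_coords_pt0 P z : has_coords P 0 1 z = (P == pt0 z).
Proof. by []. Qed.

Lemma vline_eq_scale v u : <[v]>%VS = <[u]>%VS -> exists k, v = k *: u.
Proof. by move=> eq_vu; apply/vlineP; rewrite -eq_vu memv_line. Qed.

Lemma pt1_inj y z y' z' : pt1 y z = pt1 y' z' -> y = y' /\ z = z'.
Proof.
move=> /(congr1 val)/= /vline_eq_scale[k]; rewrite scale_vec3 => eq_v.
have /eqP := congr1 (fun v => v 0 0) eq_v; rewrite !vec3E mulr1 => /eqP k1.
have := congr1 (fun v => v 0 1) eq_v; have := congr1 (fun v => v 0 2) eq_v.
by rewrite !vec3E -k1 !mul1r.
Qed.

Lemma pt0_inj : injective pt0.
Proof.
move=> z z' /(congr1 val)/= /vline_eq_scale[k]; rewrite scale_vec3 => eq_v.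
have := congr1 (fun v => v 0 1) eq_v; have := congr1 (fun v => v 0 2) eq_v.
by rewrite !vec3E mulr1 => + k1; rewrite -k1 mul1r.
Qed.

Lemma pt1_neq_pt0 y z z' : pt1 y z <> pt0 z'.
Proof.
move=> /(congr1 val)/= /vline_eq_scale[k]; rewrite scale_vec3 => eq_v.
have /eqP := congr1 (fun v => v 0 0) eq_v.
by rewrite !vec3E mulr0 oner_eq0.
Qed.

(** Divide a spanning vector by its first nonzero coordinate; which coordinate that is decides the
    case. *)
Lemma point_cases P :
  [\/ exists y z, P = pt1 y z, exists z, P = pt0 z | P = point001 F].
Proof.
have [v vP v0] : exists2 v, val P = <[v]>%VS & v != 0.
  have := valP P; exists (vpick (val P)); last first.
    by rewrite vpick0 -dimv_eq0 (eqP (valP P)).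
  apply/eqP; rewrite eq_sym eqEdim (eqP (valP P)) dim_vline vpick0 -dimv_eq0.
  by rewrite (eqP (valP P)) -memvE memv_pick.
have scale k u : v = k *: u -> val P = <[u]>%VS.
  move=> v_ku; rewrite vP; apply/eqP; rewrite eqEdim -memvE !dim_vline v0 leq_b1.
  by rewrite andbT; apply/vlineP; exists k.
have [v00|v00] := eqVneq (v 0 0) 0; last first.
  constructor 1; exists (v 0 1 / v 0 0), (v 0 2 / v 0 0).
  apply: val_inj; apply: (scale (v 0 0)).
  by rewrite scale_vec3 mulr1 !(mulrC (v 0 0)) !divfK // -vec3_eta.
have [v01|v01] := eqVneq (v 0 1) 0; last first.
  constructor 2; exists (v 0 2 / v 0 1).
  apply: val_inj; apply: (scale (v 0 1)).
  by rewrite scale_vec3 mulr1 mulr0 (mulrC (v 0 1)) divfK // -v00 -vec3_eta.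
constructor 3; apply: val_inj; apply: (scale (v 0 2)).
by rewrite scale_vec3 mulr1 mulr0 -{1}v00 -{1}v01 -vec3_eta.
Qed.

(** * Lines as kernels of linear forms, and their three types *)

Definition dotv n v : F^o := n 0 0 * v 0 0 + n 0 1 * v 0 1 + n 0 2 * v 0 2.

Lemma dotv_is_linear n : linear (dotv n).
Proof. by move=> a u w; rewrite /dotv !mxE; rewrite /GRing.scale /=; ring. Qed.

HB.instance Definition _ n :=
  GRing.isLinear.Build F 'rV[F]_3 F^o *:%R (dotv n) (dotv_is_linear n).

Lemma memv_ker_dotv n v : (v \in lker (linfun (dotv n))) = (dotv n v == 0).
Proof. by rewrite memv_ker lfunE. Qed.

(** Rank-nullity: the image lies in a one-dimensional space, and it is nonzero because the values of
    the form on the unit vectors are the coordinates of [n]. *)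
Lemma dim_ker_dotv {n} : n != 0 -> \dim (lker (linfun (dotv n))) == 2%N.
Proof.
move=> n0; have := limg_ker_dim (linfun (dotv n)) fullv.
rewrite capfv dimvf /dim /= mul1n.
have -> : limg (linfun (dotv n)) = fullv.
  apply/eqP; rewrite eqEdim subvf dimvf /dim /= lt0n dimv_eq0.
  apply: contra n0 => /eqP img0.
  have dot0 v : dotv n v = 0.
    by apply/eqP; rewrite -[dotv n v]lfunE -memv0 -img0 memv_img ?memvf.
  rewrite [n]vec3_eta; apply/eqP; move: (dot0 (vec3 1 0 0)).
  move: (dot0 (vec3 0 1 0)) (dot0 (vec3 0 0 1)).
  rewrite /dotv !vec3E !mulr0 !mulr1 !addr0 !add0r => -> -> ->.
  by rewrite -(scale0r (vec3 1 1 1)) scale_vec3 !mul0r.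
by rewrite dimvf /dim /= addn1 => -[->].
Qed.

Definition line_of n (n0 : n != 0) : line F :=
  exist _ (lker (linfun (dotv n))) (dim_ker_dotv n0).

(* The rows u and w of a basis of L are annihilated by a common nonzero linear
   form, because a 3 x 2 matrix has a nonzero left kernel. *)
Lemma line_eq L : exists n, exists n0 : n != 0, L = line_of n0.
Proof.
pose X := vbasis (val L); have szX := eqP (valP L).
pose A : 'M[F]_(3, \dim (val L)) := \matrix_(i, j) X`_j 0 i.
have: kermx A != 0.
  rewrite kermx_eq0 /row_free neq_ltn; apply/orP; left.
  by rewrite (leq_ltn_trans (rank_leq_col A)) // szX.
case/rowV0Pn => n; rewrite sub_kermx => /eqP nA n0.
exists n, n0; apply: val_inj; apply/eqP.
rewrite eqEdim szX (eqP (dim_ker_dotv n0)) andbT.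
rewrite -(span_basis (vbasisP (val L))); apply/span_subvP => w.
case/(nthP 0) => j; rewrite size_tuple => lt_j <-.
rewrite memv_ker_dotv; apply/eqP.
have /(congr1 (fun B : 'rV_ _ => B 0 (Ordinal lt_j))) := nA.
rewrite !mxE !big_ord_recl big_ord0 !mxE addr0 addrA /dotv => <-.
by congr (_ * _ + _ * _ + _ * _); congr (_ _ _); apply: val_inj.
Qed.

Lemma incident_pt1 n (n0 : n != 0) y z :
  incident (pt1 y z) (line_of n0) = (n 0 0 + n 0 1 * y + n 0 2 * z == 0).
Proof. by rewrite /incident -memvE memv_ker_dotv /dotv !vec3E mulr1. Qed.

Lemma incident_pt0 n (n0 : n != 0) z :
  incident (pt0 z) (line_of n0) = (n 0 1 + n 0 2 * z == 0).
Proof. by rewrite /incident -memvE memv_ker_dotv /dotv !vec3E mulr1 mulr0 add0r. Qed.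

Lemma incident_point001 n (n0 : n != 0) :
  incident (point001 F) (line_of n0) = (n 0 2 == 0).
Proof.
by rewrite /incident -memvE memv_ker_dotv /dotv !vec3E mulr1 !mulr0 !add0r.
Qed.

(** These are the lines Y = cX, recorded by their incidences with the three kinds of points, so that
    later counts need no normal vector. [has_slope] does the same for Z = mY + cX. *)
Definition is_vertical L c :=
  [/\ forall y z, incident (pt1 y z) L = (y == c),
      forall z, incident (pt0 z) L = false & incident (point001 F) L].

Definition has_slope L m c :=
  [/\ forall y z, incident (pt1 y z) L = (z == m * y + c),
      forall z, incident (pt0 z) L = (z == m) & incident (point001 F) L = false].

Lemma memv_lineX0 v : (v \in val (lineX0 F)) = (v 0 0 == 0).
Proof. by rewrite memv_ker coordXE. Qed.

Lemma lineX0_incident :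
  [/\ forall y z, incident (pt1 y z) (lineX0 F) = false,
      forall z, incident (pt0 z) (lineX0 F) & incident (point001 F) (lineX0 F)].
Proof.
by split=> *; rewrite /incident -memvE memv_lineX0 vec3E ?eqxx // oner_eq0.
Qed.

(** Solve the equation of the line for the last coordinate that has a nonzero coefficient; if only
    the first coefficient is nonzero, the line is X = 0. *)
Lemma line_cases L :
  [\/ L = lineX0 F, exists c, is_vertical L c | exists m c, has_slope L m c].
Proof.
have [n [n0 ->]] := line_eq L.
have [n2|n2] := eqVneq (n 0 2) 0; last first.
  constructor 3; exists (- n 0 1 / n 0 2), (- n 0 0 / n 0 2).
  split=> [y z|z|]; last by rewrite incident_point001 (negbTE n2).
    rewrite incident_pt1 -[RHS](inj_eq (mulfI n2)) -[RHS]subr_eq0.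
    by congr (_ == _); field.
  rewrite incident_pt0 -[RHS](inj_eq (mulfI n2)) -[RHS]subr_eq0.
  by congr (_ == _); field.
have [n1|n1] := eqVneq (n 0 1) 0; last first.
  constructor 2; exists (- n 0 0 / n 0 1).
  split=> [y z|z|]; last by rewrite incident_point001 n2.
    rewrite incident_pt1 n2 -[RHS](inj_eq (mulfI n1)) -[RHS]subr_eq0.
    by congr (_ == _); field.
  by rewrite incident_pt0 n2 mul0r addr0 (negbTE n1).
constructor 1; apply: val_inj; apply/vspaceP => v.
rewrite memv_lineX0 /= memv_ker_dotv /dotv n1 n2 !mul0r !addr0 mulf_eq0.
case: eqP => //= n00; case/eqP: n0.
by rewrite [n]vec3_eta n00 n1 n2 -(scale0r (vec3 1 1 1)) scale_vec3 !mul0r.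
Qed.

Lemma vertical_line c : exists L, is_vertical L c.
Proof.
have n0 : vec3 (- c) 1 0 != 0.
  apply/eqP => /(congr1 (fun v : 'rV_3 => v 0 1)) /eqP.
  by rewrite vec3E mxE oner_eq0.
exists (line_of n0); split=> [y z|z|].
- by rewrite incident_pt1 !vec3E mul1r mul0r addr0 addrC subr_eq0.
- by rewrite incident_pt0 !vec3E mul0r addr0 oner_eq0.
by rewrite incident_point001 vec3E.
Qed.

Lemma slope_line m c : exists L, has_slope L m c.
Proof.
have n0 : vec3 (- c) (- m) 1 != 0.
  apply/eqP => /(congr1 (fun v : 'rV_3 => v 0 2)) /eqP.
  by rewrite vec3E mxE oner_eq0.
exists (line_of n0); split=> [y z|z|].
- rewrite incident_pt1 !vec3E -[RHS]subr_eq0; congr (_ == _); ring.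
- by rewrite incident_pt0 !vec3E mul1r addrC subr_eq0.
by rewrite incident_point001 vec3E oner_eq0.
Qed.

(** * The elations with axis X = 0 and centre (0,0,1) *)

Definition shear_fun s v := v + (s * v 0 0) *: vec3 0 0 1.

Lemma shear_fun_is_linear s : linear (shear_fun s).
Proof.
move=> a u w; rewrite /shear_fun !mxE scalerDr !scalerA addrACA -scalerDl.
by congr (_ + _ *: _); ring.
Qed.

HB.instance Definition _ s :=
  GRing.isLinear.Build F 'rV[F]_3 'rV[F]_3 *:%R (shear_fun s)
    (shear_fun_is_linear s).

Definition shear s : 'End('rV[F]_3) := linfun (shear_fun s).

Lemma shearE s v : shear s v = v + (s * v 0 0) *: vec3 0 0 1.
Proof. by rewrite lfunE. Qed.

Lemma shearK s : (shear (- s) \o shear s = \1)%VF.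
Proof.
apply/lfunP => v; rewrite comp_lfunE id_lfunE !shearE !mxE /= mulr0 addr0.
by rewrite -addrA -scalerDl mulNr subrr scale0r addr0.
Qed.

Lemma lker_shear s : lker (shear s) = 0%VS.
Proof.
apply/eqP/lker0P => u v /(congr1 (shear (- s))).
by rewrite -!comp_lfunE shearK !id_lfunE.
Qed.

Lemma dim_shear s d (U : {vspace 'rV[F]_3}) :
  \dim U == d -> \dim (shear s @: U) == d.
Proof. by rewrite limg_dim_eq // lker_shear capv0. Qed.

Definition shear_point s P : point F :=
  exist _ (shear s @: val P)%VS (dim_shear s (valP P)).
Definition shear_line s L : line F :=
  exist _ (shear s @: val L)%VS (dim_shear s (valP L)).

Lemma shear_imgK s (U : {vspace 'rV[F]_3}) : (shear (- s) @: (shear s @: U) = U)%VS.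
Proof. by rewrite -limg_comp shearK lim1g. Qed.

Lemma shear_pointK s : cancel (shear_point s) (shear_point (- s)).
Proof. by move=> P; apply: val_inj; rewrite /= shear_imgK. Qed.

Definition shear_perm s : {perm point F} := perm (can_inj (shear_pointK s)).

Lemma shear_perm_pt1 s y z : shear_perm s (pt1 y z) = pt1 y (z + s).
Proof.
apply: val_inj; rewrite permE /= limg_line shearE vec3E mulr1; congr <[_]>%VS.
by rewrite [LHS]vec3_eta !mxE /= !mulr0 mulr1 !addr0.
Qed.

Lemma shear_incident s P L :
  incident (shear_point s P) (shear_line s L) = incident P L.
Proof.
apply/idP/idP => [|PL]; last exact: limgS.
by move/(limgS (shear (- s))); rewrite !shear_imgK.
Qed.

Lemma imset_shear_points_on s L :
  shear_perm s @: points_on L = points_on (shear_line s L).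
Proof.
apply/setP => P; have eqP' : P = shear_perm s (shear_point (- s) P).
  by rewrite permE -{1}[s]opprK shear_pointK.
by rewrite eqP' mem_imset ?inE ?permE ?shear_incident //; apply: perm_inj.
Qed.

Lemma shear_fixX0 s P : incident P (lineX0 F) -> shear_perm s P = P.
Proof.
move=> PX0; apply: val_inj; rewrite permE /= -[RHS]lim1g; apply: eq_in_limg => v.
move/(subvP PX0); rewrite memv_lineX0 shearE id_lfunE => /eqP ->.
by rewrite mulr0 scale0r addr0.
Qed.

(** A shear moves each vector by a multiple of (0,0,1), so it maps every line through that point
    into itself; equality follows by dimension. *)
Lemma shear_elation s : elation_with_axis (lineX0 F) (shear_perm s).
Proof.
have [_ _ RX0] := lineX0_incident.
exists (point001 F); split=> //.
- by move=> L; exists (shear_line s L); apply: imset_shear_points_on.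
- exact: shear_fixX0.
move=> M RM; rewrite imset_shear_points_on; congr (points_on _).
apply: val_inj; apply/eqP; rewrite eqEdim (eqP (valP M)) /=.
rewrite (eqP (dim_shear s (valP M))) andbT.
apply/subvP => _ /memv_imgP[v vM ->]; by rewrite shearE memvD ?memvZ.
Qed.

End Plane.

(** * The finite verification over F_2 *)

(** Unlike a bare case analysis, this leaves the closed terms 0 and 1, without variable bound
    proofs, so that the resulting goals compute. *)
Lemma F2_ind (P : 'F_2 -> Prop) : P 0 -> P 1 -> forall a, P a.
Proof.
move=> P0 P1 [[|[|//]] lt_a].
  by have -> : Ordinal lt_a = 0 by apply: val_inj.
by have -> : Ordinal lt_a = 1 by apply: val_inj.
Qed.

Lemma sum_F2 (G : 'F_2 -> nat) : (\sum_x G x = G 0%R + G 1%R)%N.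
Proof.
rewrite !big_ord_recl big_ord0 addn0.
by congr (G _ + G _)%N; apply: val_inj.
Qed.

Lemma ord3_ind (P : 'I_3 -> Prop) : P 0 -> P 1 -> P 2 -> forall i, P i.
Proof.
move=> P0 P1 P2 [[|[|[|//]]] lt_i].
- by have -> : Ordinal lt_i = 0 by apply: val_inj.
- by have -> : Ordinal lt_i = 1 by apply: val_inj.
by have -> : Ordinal lt_i = 2 by apply: val_inj.
Qed.

Lemma sum_ord3 (V : nmodType) (G : 'I_3 -> V) : \sum_i G i = G 0 + G 1 + G 2.
Proof.
rewrite !big_ord_recl big_ord0 addr0 addrA.
by congr (_ + G _ + G _); apply: val_inj.
Qed.

Lemma forall_ord3 (P : pred 'I_3) : [forall i, P i] = [&& P 0, P 1 & P 2].
Proof.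
apply/forallP/and3P => [Pi|[P0 P1 P2]]; first by split.
exact: ord3_ind.
Qed.

(** Turns a count over finite functions into an iterated sum that can be expanded and evaluated. *)
Lemma card_F2_cube (Q : 'F_2 -> 'F_2 -> 'F_2 -> bool) :
  #|[set l : {ffun 'I_3 -> 'F_2} | Q (l 0) (l 1) (l 2)]| =
  (\sum_x \sum_y \sum_z Q x y z)%N.
Proof.
pose g (p : 'F_2 * ('F_2 * 'F_2)) : {ffun 'I_3 -> 'F_2} :=
  [ffun i : 'I_3 => [:: p.1; p.2.1; p.2.2]`_i].
pose g' (l : {ffun 'I_3 -> 'F_2}) := (l 0, (l 1, l 2)).
have gK : cancel g g' by case=> x [y z]; rewrite /g' !ffunE.
have g'K : cancel g' g.
  by move=> l; apply/ffunP; apply: ord3_ind; rewrite ffunE.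
rewrite -sum1_card big_mkcond (reindex g) /=; last first.
  by exists g' => l _; [apply: gK | apply: g'K].
under [RHS]eq_bigr => x _ do rewrite pair_bigA /=.
rewrite pair_bigA; apply: eq_bigr => p _.
by rewrite inE !ffunE /=; case: (Q _ _ _).
Qed.

Definition solutions (M : 'I_3 -> 'I_3 -> 'F_2) (C : 'I_3 -> 'F_2) :
    {set {ffun 'I_3 -> 'F_2}} :=
  [set l : {ffun 'I_3 -> 'F_2} | [forall i,
     \sum_j l j * M i j + C i + f_ i (l 0) (l 1) (l 2) == 0]].

(* The first summand stands for the point at infinity of the line attached to
   (M, C): it is in the arc iff M is alternating. *)
Lemma card_solutions (M : 'I_3 -> 'I_3 -> 'F_2) (C : 'I_3 -> 'F_2) :
  (forall i j, M i j = M j i) ->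
  ([forall i, M i i == 0%R] + #|solutions M C|)%N \in [:: 0%N; 2%N].
Proof.
move=> symM.
pose Q (x y z : 'F_2) := [&& x * M 0 0 + y * M 0 1 + z * M 0 2 + C 0 + f1 x y z == 0,
                    x * M 0 1 + y * M 1 1 + z * M 1 2 + C 1 + f2 x y z == 0
                  & x * M 0 2 + y * M 1 2 + z * M 2 2 + C 2 + f3 x y z == 0].
have -> : #|solutions M C| = (\sum_x \sum_y \sum_z Q x y z)%N.
  rewrite -card_F2_cube; apply: eq_card => l.
  by rewrite !inE forall_ord3 !sum_ord3 (symM 1 0) (symM 2 0) (symM 2 1).
rewrite !sum_F2 forall_ord3 {}/Q.
(* By symmetry [Q] involves six entries of [M]; with the three of [C] there are 2^9 closed cases. *)
move: (M 0 0) (M 0 1) (M 0 2) (M 1 1) (M 1 2) (M 2 2) (C 0) (C 1) (C 2).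
do 9!elim/F2_ind; vm_compute; reflexivity.
Qed.

(** * The absolute trace *)

Section Trace.

Variables (F : finFieldType) (h : nat).
Hypothesis cardF : #|F| = (2 ^ h)%N.
Implicit Types (x y : F) (a b : 'F_2).

Lemma pchar2 : 2 \in [pchar F].
Proof. exact: card_finPcharP cardF _. Qed.

Lemma abs_traceE x : abs_trace x = \sum_(i < h) x ^+ (2 ^ i).
Proof. by rewrite /abs_trace cardF pfactorK. Qed.

Lemma expr2k_add x y k : (x + y) ^+ (2 ^ k) = x ^+ (2 ^ k) + y ^+ (2 ^ k).
Proof.
apply: exprDn_pchar; rewrite pnatX; apply/orP; left.
by rewrite pnatE //; apply: pchar2.
Qed.

Lemma abs_traceD x y : abs_trace (x + y) = abs_trace x + abs_trace y.
Proof.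
rewrite !abs_traceE -big_split.
by apply: eq_bigr => i _; apply: expr2k_add.
Qed.

Lemma abs_trace0 : abs_trace (0 : F) = 0.
Proof. by apply: (addrI (abs_trace 0)); rewrite -abs_traceD !addr0. Qed.

(** Squaring shifts the conjugates of [x] cyclically, since x^(2^h) = x. *)
Lemma abs_trace_sqr x : abs_trace (x ^+ 2) = abs_trace x.
Proof.
rewrite !abs_traceE; case: h cardF => [|k] cardFk; first by rewrite !big_ord0.
rewrite big_ord_recr [RHS]big_ord_recl addrC /= -exprM -expnS -cardFk expf_card.
by congr (_ + _); apply: eq_bigr => i _; rewrite -exprM -expnS.
Qed.

(** Squaring is additive in characteristic 2, so the square of the trace is the trace of the square.
    Hence the trace takes only the values 0 and 1. *)
Lemma sqr_abs_trace x : abs_trace x ^+ 2 = abs_trace x.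
Proof.
rewrite -[RHS]abs_trace_sqr !abs_traceE.
rewrite (big_morph (fun y => y ^+ 2) (fun y z => expr2k_add y z 1) (expr0n _ 2)).
by apply: eq_bigr => i _; rewrite -!exprM mulnC.
Qed.

(** The trace with values in ['F_2] instead of the prime subfield of [F]. Its identities are pulled
    back along the injection [F2_to]. *)
Definition tr x : 'F_2 := (abs_trace x != 0)%:R.

Lemma F2_to_nat (b : bool) : F2_to F b%:R = b%:R.
Proof. by case: b. Qed.

(** A nonzero idempotent of a field is 1. *)
Lemma F2_to_tr x : F2_to F (tr x) = abs_trace x.
Proof.
rewrite F2_to_nat; have [->//|nz] := eqVneq.
by apply: (mulfI nz); rewrite mulr1 -expr2 sqr_abs_trace.
Qed.

Lemma F2_to_inj : injective (F2_to F).
Proof.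
by do 2!elim/F2_ind=> //; move=> /eqP; rewrite /F2_to /= ?[0 == _]eq_sym oner_eq0.
Qed.

Lemma F2_toD a b : F2_to F (a + b) = F2_to F a + F2_to F b.
Proof.
move: a b; do 2!elim/F2_ind=> //; rewrite ?addr0 ?add0r //.
by rewrite /F2_to /= addrr_pchar2 // pchar2.
Qed.

Lemma trD x y : tr (x + y) = tr x + tr y.
Proof. by apply: F2_to_inj; rewrite F2_toD !F2_to_tr abs_traceD. Qed.

Lemma tr0 : tr 0 = 0.
Proof. by rewrite /tr abs_trace0 eqxx. Qed.

Lemma tr_sqr x : tr (x ^+ 2) = tr x.
Proof. by rewrite /tr abs_trace_sqr. Qed.

Lemma abs_trace_eq0 x : (abs_trace x == 0) = (tr x == 0).
Proof. by rewrite /tr; case: eqP. Qed.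

Lemma trZ a x : tr (F2_to F a * x) = a * tr x.
Proof. by elim/F2_ind: a; rewrite ?mul0r ?tr0 // !mul1r. Qed.

Lemma sqrf_inj : injective (fun x => x ^+ 2).
Proof.
move=> x y /eqP; rewrite eqf_sqr oppr_pchar2 ?pchar2 // orbb.
by move/eqP.
Qed.

(** * Combinations over F_2 and their traces *)

Definition comb (v : 'I_3 -> F) (c : {ffun 'I_3 -> 'F_2}) : F :=
  \sum_i F2_to F (c i) * v i.

Lemma combD v (c d : {ffun 'I_3 -> 'F_2}) :
  comb v [ffun i => c i + d i] = comb v c + comb v d.
Proof.
by rewrite -big_split; apply: eq_bigr => i _; rewrite ffunE F2_toD mulrDl.
Qed.

Lemma tr_comb y v (c : {ffun 'I_3 -> 'F_2}) :
  tr (y * comb v c) = \sum_i c i * tr (y * v i).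
Proof.
rewrite mulr_sumr (big_morph tr trD tr0); apply: eq_bigr => i _.
by rewrite mulrCA trZ.
Qed.

(** In characteristic 2 the sum of two coefficient vectors is also their difference, so independence
    applies to the sum. *)
Lemma comb_inj v : F2_independent v -> injective (comb v).
Proof.
move=> indep c d eq_cd; apply/ffunP => i.
have two : 2 \in [pchar 'F_2] by apply: pchar_Fp.
have sum0 : comb v [ffun i => c i + d i] = 0.
  by rewrite combD eq_cd addrr_pchar2 // pchar2.
have := indep _ sum0 i; rewrite ffunE => /eqP.
by rewrite addr_eq0 oppr_pchar2 // => /eqP.
Qed.

End Trace.

(** * The arc *)

Lemma imset_setI (T1 T2 : finType) (f : T1 -> T2) (D : {set T1}) (B : {set T2}) :
  f @: D :&: B = f @: [set x in D | f x \in B].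
Proof.
apply/setP => y; rewrite inE; apply/andP/imsetP.
  by case=> /imsetP[x xD ->] fxB; exists x; rewrite // inE xD.
by case=> x; rewrite inE => /andP[xD fxB] ->; rewrite imset_f.
Qed.

Section Arc.

Variables (h : nat) (F : finFieldType) (alpha beta : 'I_3 -> F).
Hypothesis h_ge4 : (4 <= h)%N.
Hypothesis cardF : #|F| = (2 ^ h)%N.
Hypothesis alpha_indep : F2_independent alpha.
Hypothesis alpha_beta :
  forall i j, abs_trace (alpha i * beta j) = (i == j)%:R.
Implicit Types (l : {ffun 'I_3 -> 'F_2}) (L : line F) (m c s x y z : F).

Local Notation S := (set_S alpha).
Local Notation A := (arc_A alpha beta).
Local Notation t := (#|F| %/ 8)%N.

(** * Parametrisation and size of the arc *)

Definition fval l : {ffun 'I_3 -> 'F_2} := [ffun i => f_ i (l 0) (l 1) (l 2)].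

Definition T0 : {set F} :=
  [set x | [forall i, abs_trace (alpha i ^+ 2 * x) == 0]].

Definition affine_pt (p : {ffun 'I_3 -> 'F_2} * F) : point F :=
  pt1 (comb alpha p.1) (comb beta (fval p.1) + p.2).

(** The arc is described by parameters in [T0] and in F_2^3 x [S]. Both parametrisations are
    injective with disjoint images, so all later counts take place on parameters. *)
Lemma arc_A_decomp : A = @pt0 F @: T0 :|: affine_pt @: setX setT S.
Proof.
apply/setP => P; rewrite !in_setU; congr (_ || _).
  rewrite inE; apply/existsP/imsetP => [[x /andP[xT /eqP Px]]|[x xT ->]].
    by exists x; [rewrite inE | apply: val_inj].
  by exists x; rewrite inE in xT; rewrite xT has_coords_pt0 eqxx.
have fvalE l : comb beta (fval l) =
    \sum_i F2_to F (f_ i (l 0) (l 1) (l 2)) * beta i.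
  by apply: eq_bigr => i _; rewrite ffunE.
apply/bigcupP/imsetP => [[l _]|[[l s]]].
  rewrite inE => /existsP[s /andP[sS /eqP Ps]]; exists (l, s).
    by rewrite !inE in sS *.
  by apply: val_inj; rewrite /= fvalE.
rewrite inE => /andP[_ sS] ->; exists l => //.
rewrite inE; apply/existsP; exists s; rewrite sS has_coords_pt1 -fvalE.
exact: eqxx.
Qed.

Lemma affine_pt_inj : injective affine_pt.
Proof.
case=> l s [l' s'] /pt1_inj[] /= /(comb_inj cardF alpha_indep) <-.
by move/addrI <-.
Qed.

Lemma card_arc_setI (B : {set point F}) :
  #|A :&: B| = (#|[set x in T0 | pt0 x \in B]| +
                #|[set p in setX setT S | affine_pt p \in B]|)%N.
Proof.
rewrite arc_A_decomp setIUl !imset_setI cardsU disjoint_setI0 ?cards0 ?subn0.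
  by rewrite !card_imset //; [apply: affine_pt_inj | apply: pt0_inj].
apply/pred0P => P; apply/negP => /andP[/imsetP[x _ ->] /imsetP[p _]].
by move/esym/pt1_neq_pt0.
Qed.

Lemma mem_S x : (x \in S) = [forall i, tr (alpha i * x) == 0].
Proof. by rewrite inE; apply: eq_forallb => i; rewrite abs_trace_eq0. Qed.

(** Rewrites the condition as the vanishing of the diagonal of the matrix M_ij = Tr(alpha_i x
    alpha_j), the form needed for [card_solutions]. *)
Lemma mem_T0 x : (x \in T0) = [forall i, tr (alpha i * (x * alpha i)) == 0].
Proof.
rewrite inE; apply: eq_forallb => i; rewrite abs_trace_eq0.
by rewrite expr2 -mulrA (mulrC x).
Qed.

Lemma S_add s s' : s \in S -> s' \in S -> s + s' \in S.
Proof.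
rewrite !mem_S => /forallP sS /forallP s'S; apply/forallP => i.
by rewrite mulrDr (trD cardF) (eqP (sS i)) (eqP (s'S i)) addr0.
Qed.

(** The [beta] are dual to the [alpha] under the trace form, so the trace against [alpha i] reads
    off the i-th coefficient. *)
Lemma tr_comb_beta i l : tr (alpha i * comb beta l) = l i.
Proof.
have tr_ab j : tr (alpha i * beta j) = (i == j)%:R.
  by rewrite /tr alpha_beta; case: (i == j); rewrite ?oner_eq0 ?eqxx.
rewrite (tr_comb cardF) (bigD1 i) //= tr_ab eqxx mulr1 big1 ?addr0 // => j.
by rewrite tr_ab eq_sym => /negbTE ->; rewrite mulr0.
Qed.

Lemma card_F2cube : #|{: {ffun 'I_3 -> 'F_2}}| = 8.
Proof. by rewrite card_ffun !card_ord. Qed.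

(* Every x decomposes uniquely as the sum of \sum_i Tr(alpha_i x) beta_i and an
   element of S. *)
Lemma card_F8S : #|F| = (8 * #|S|)%N.
Proof.
pose g (p : {ffun 'I_3 -> 'F_2} * F) := comb beta p.1 + p.2.
have g_tr i p : p.2 \in S -> tr (alpha i * g p) = p.1 i.
  rewrite mem_S => /forallP/(_ i)/eqP pS.
  by rewrite mulrDr (trD cardF) pS addr0 tr_comb_beta.
have g_inj : {in setX setT S &, injective g}.
  move=> [l s] [l' s']; rewrite !in_setX !in_setT /= => sS s'S eq_g.
  have eq_l : l = l'.
    by apply/ffunP => i; rewrite -(g_tr i (l, s)) // eq_g g_tr.
  by move: eq_g; rewrite eq_l => /addrI /= ->.
have g_onto : g @: setX setT S = setT.
  apply/setP => x; rewrite inE; apply/imsetP.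
  pose l := [ffun i => tr (alpha i * x)]; exists (l, x - comb beta l).
    rewrite in_setX in_setT mem_S; apply/forallP => i /=.
    (* In characteristic 2 the difference is a sum, to which additivity of the trace applies. *)
    rewrite -(oppr_pchar2 (pchar2 cardF) (comb beta l)) opprK.
    rewrite mulrDr (trD cardF) tr_comb_beta ffunE.
    by rewrite addrr_pchar2 // pchar_Fp.
  by rewrite /g /= addrC subrK.
by have := card_in_imset g_inj; rewrite g_onto cardsT cardsX cardsT card_F2cube.
Qed.

Lemma card_S : #|S| = t.
Proof. by rewrite card_F8S mulKn. Qed.

(** Since Tr(alpha_i^2 x^2) = Tr(alpha_i x), the set [S] is the preimage of [T0] under the bijection
    x -> x^2. *)
Lemma card_T0 : #|T0| = t.
Proof.
rewrite -card_S; have sqr_bij := injF_bij (sqrf_inj cardF).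
rewrite -(on_card_preimset (onW_bij _ sqr_bij)).
apply: eq_card => x; rewrite inE inE mem_S; apply: eq_forallb => i.
by rewrite abs_trace_eq0 -exprMn (tr_sqr cardF).
Qed.

Lemma card_arc : #|A| = (#|F| + t)%N.
Proof.
rewrite -[A]setIT card_arc_setI.
have -> : [set x in T0 | pt0 x \in [set: point F]] = T0.
  by apply/setP => x; rewrite !inE andbT.
have -> : [set p in setX setT S | affine_pt p \in [set: point F]] = setX setT S.
  by apply/setP => x; rewrite !inE andbT.
by rewrite cardsX cardsT card_F2cube card_T0 -card_F8S addnC.
Qed.

(** * Intersections of the arc with the three types of lines *)

Lemma card_arc_X0 : #|A :&: points_on (lineX0 F)| = t.
Proof.
have [pt1X0 pt0X0 _] := lineX0_incident F.
rewrite card_arc_setI -card_T0 -[RHS]addn0; congr (_ + _)%N.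
  by apply: eq_card => x; rewrite [LHS]inE [pt0 x \in _]inE pt0X0 andbT.
by apply: eq_card0 => p; rewrite [LHS]inE [affine_pt p \in _]inE pt1X0 andbF.
Qed.

(** Independence of the [alpha] makes the index of the set on this line unique; the boolean factor
    covers the case that there is none. *)
Lemma card_arc_vertical L c : is_vertical L c ->
  #|A :&: points_on L| = (t * (c \in codom (comb alpha)))%N.
Proof.
case=> pt1L pt0L _; rewrite card_arc_setI eq_card0 ?add0n; last first.
  by move=> x; rewrite [LHS]inE [pt0 x \in _]inE pt0L andbF.
case: codomP => [[l c_l]|c_l].
  transitivity #|setX [set l] S|; last by rewrite cardsX cards1 mul1n muln1 card_S.
  apply: eq_card => -[l' s].
  rewrite [LHS]inE [affine_pt _ \in _]inE pt1L !in_setX in_set1 in_setT /= andbC c_l.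
  by rewrite (inj_eq (comb_inj cardF alpha_indep)).
rewrite muln0 eq_card0 // => p; rewrite [LHS]inE [affine_pt _ \in _]inE pt1L.
by apply/negP => /andP[_ /eqP p_c]; case: c_l; exists p.1.
Qed.

(** The first summand counts the point (0,1,m). For each index [l] the line determines the only
    possible [s], so it remains to ask whether that [s] lies in [S]. *)
Lemma card_arc_slope L m c : has_slope L m c ->
  #|A :&: points_on L| =
  ((m \in T0) +
    #|[set l | (m * comb alpha l + c - comb beta (fval l))%R \in S]|)%N.
Proof.
case=> pt1L pt0L _; rewrite card_arc_setI; congr (_ + _)%N.
  have [mT|mT] := boolP (m \in T0).
    transitivity #|[set m]|; last by rewrite cards1.
    apply: eq_card => x; rewrite [LHS]inE [pt0 x \in _]inE pt0L in_set1.
    by have [->|] := eqVneq x m; rewrite ?mT ?andbF.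
  apply: eq_card0 => x; rewrite [LHS]inE [pt0 x \in _]inE pt0L.
  by apply: contraNF mT => /andP[+ /eqP <-].
pose g l := (l, m * comb alpha l + c - comb beta (fval l)).
have g_inj : injective g by move=> l l' [].
rewrite -(card_imset _ g_inj); apply: eq_card => -[l s].
rewrite [LHS]inE [affine_pt _ \in _]inE pt1L in_setX in_setT /=.
rewrite (addrC (comb beta _)) [_ == _]eq_sym -subr_eq.
apply/andP/imsetP => [[sS /eqP s_eq]|[l']].
  by exists l; [rewrite [l \in _]inE s_eq | rewrite /g s_eq].
by rewrite [l' \in _]inE => l'S [-> ->].
Qed.

Lemma slope_secant L m c : has_slope L m c ->
  #|A :&: points_on L| \in [:: 0%N; 2].
Proof.
move/card_arc_slope->; rewrite mem_T0.
pose M i j := tr (alpha i * (m * alpha j)); pose C i := tr (alpha i * c).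
rewrite (_ : finset _ = solutions M C); first last.
  (* By duality the trace of [alpha i] times [comb beta (fval l)] is f_i(l), so the i-th condition
     for membership in [S] is the i-th equation of the system. *)
  apply/setP => l; rewrite [LHS]inE [RHS]inE mem_S; apply: eq_forallb => i.
  rewrite -(oppr_pchar2 (pchar2 cardF) (comb beta _)) opprK.
  rewrite !mulrDr !(trD cardF) tr_comb_beta ffunE mulrA (tr_comb cardF).
  by congr (_ + _ + _ == _); apply: eq_bigr => j _; rewrite /M mulrA.
apply: card_solutions => i j; rewrite /M; congr tr; ring.
Qed.

Lemma t_ge2 : (2 <= t)%N.
Proof. by rewrite cardF leq_divRL // (@leq_exp2l 2 4). Qed.

Lemma arc_secants L :
  [|| secant 0 A L, secant 2 A L | secant t A L].
Proof.
rewrite /secant; have [->|[c Lc]|[m [c Lmc]]] := line_cases L.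
- by rewrite card_arc_X0 eqxx !orbT.
- rewrite (card_arc_vertical Lc).
  by case: (_ \in _); rewrite ?muln0 ?muln1 eqxx ?orbT.
by have := slope_secant Lmc; rewrite !inE => /orP[->|->]; rewrite ?orbT.
Qed.

Lemma arc_KM_arc : KM_arc t A.
Proof.
split; [exact: card_arc | exact: arc_secants | split].
(* The map [comb alpha] has at most 8 values; were it onto, [t] would be at most 1. For a value [c]
   that is missed, the line Y = cX is a 0-secant. *)
- have [c cNa] : exists c : F, c \notin codom (comb alpha).
    apply/existsP; rewrite -negb_forall; apply: contraL t_ge2 => /forallP onto.
    have : (#|F| <= 8)%N.
      rewrite (leq_trans _ (eq_leq card_F2cube)) //.
      apply: leq_trans (leq_image_card (comb alpha) _).
      by apply/subset_leq_card/subsetP => c _; apply: onto.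
    by rewrite -leqNgt => /(leq_div2r 8).
  have [L Lc] := vertical_line c; exists L.
  by rewrite /secant (card_arc_vertical Lc) (negbTE cNa) muln0.
(* The line Z = 0 contains the point (0,1,0) of [S_0], so it is not a 0-secant and must be a
   2-secant. *)
- have [L L00] := @slope_line F 0 0; exists L.
  have := slope_secant L00; rewrite !inE => /orP[|//].
  rewrite (card_arc_slope L00) mem_T0 => /eqP/eqP.
  rewrite addn_eq0 eqb0; case/andP => /negP[]; apply/forallP => i.
  by rewrite mul0r mulr0 (tr0 cardF).
by exists (lineX0 F); rewrite /secant card_arc_X0.
Qed.

(** * Elations stabilising the arc, transitivity and the nucleus *)

Lemma shear_stabilises s : s \in S -> stabilises (shear_perm s) A.
Proof.
(* Inclusion suffices because a permutation preserves cardinality. Points of [S_0] lie on the axis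
   and stay fixed; on the others the parameter in [S] is translated by [s]. *)
move=> sS; apply/eqP; rewrite eqEcard card_imset ?leqnn ?andbT; last exact: perm_inj.
have [_ pt0X0 _] := lineX0_incident F.
apply/subsetP => _ /imsetP[P PA ->]; move: PA; rewrite arc_A_decomp !in_setU.
case/orP=> [/imsetP[x xT ->]|/imsetP[[l s'] ls' ->]].
  by rewrite shear_fixX0 // imset_f.
apply/orP; right; rewrite /affine_pt /= shear_perm_pt1 -addrA.
apply/imsetP; exists (l, s' + s) => //.
by move: ls'; rewrite !in_setX !in_setT /= => /S_add; apply.
Qed.

(** A line with a slope meets the arc in 0 or 2 points, which is less than [t]. *)
Lemma secant_t_vertical L :
  (2 < t)%N -> secant t A L -> L != lineX0 F -> exists c, is_vertical L c.
Proof.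
move=> t_gt2 /eqP Lt LX0; have [L0|//|[m [c /slope_secant]]] := line_cases L.
  by rewrite L0 eqxx in LX0.
by rewrite Lt !inE !gtn_eqF // ltnW // ltnW.
Qed.

Lemma arc_transitive L P Q :
  (2 < t)%N -> secant t A L -> L != lineX0 F ->
  P \in A :&: points_on L -> Q \in A :&: points_on L ->
  exists g, [/\ elation_with_axis (lineX0 F) g, stabilises g A & g P = Q].
Proof.
move=> t_gt2 Lt LX0; have [c [pt1L pt0L _]] := secant_t_vertical t_gt2 Lt LX0.
have onL R : R \in A :&: points_on L -> exists l s,
    [/\ s \in S, comb alpha l = c & R = affine_pt (l, s)].
  rewrite arc_A_decomp inE [R \in points_on L]inE in_setU.
  case/andP=> /orP[] /imsetP[] => [x _ ->|[l s]]; first by rewrite pt0L.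
  by rewrite in_setX => /andP[_ sS] ->; rewrite pt1L => /eqP; exists l, s.
case/onL=> l [s [sS lc ->]] /onL[l' [s' [s'S l'c ->]]].
have <- : l = l'.
  by apply: (comb_inj cardF alpha_indep); rewrite lc.
(* In characteristic 2, s + (s + s') = s'. *)
exists (shear_perm (s + s')); split.
- exact: shear_elation.
- exact/shear_stabilises/S_add.
rewrite shear_perm_pt1 -addrA; congr (pt1 _ (_ + _)).
by rewrite addrA addrr_pchar2 ?add0r // (pchar2 cardF).
Qed.

Lemma arc_nucleus : (2 < t)%N -> nucleus t A (point001 F).
Proof.
move=> t_gt2 P; have [pt1X0 pt0X0 RX0] := lineX0_incident F.
split=> [Pt|-> L Lt]; last first.
  have [->//|LX0] := eqVneq L (lineX0 F).
  by have [c []] := secant_t_vertical t_gt2 Lt LX0.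
have PX0 : incident P (lineX0 F) by apply: Pt; rewrite /secant card_arc_X0.
(* The index 0 gives a second [t]-secant, which meets X = 0 only in (0,0,1). *)
have [L La] := vertical_line (comb alpha [ffun=> 0]).
have PL : incident P L.
  by apply: Pt; rewrite /secant (card_arc_vertical La) codom_f muln1.
have [_ pt0L _] := La; have [[y [z P1]]|[z P0]|//] := point_cases P.
  by rewrite P1 pt1X0 in PX0.
by rewrite P0 pt0L in PL.
Qed.

End Arc.

Unset Implicit Arguments.

Theorem theorem4p4 (h : nat) (F : finFieldType) (alpha beta : 'I_3 -> F)
    (h_ge4 : (4 <= h)%N) (cardF : #|F| = (2 ^ h)%N)
    (alpha_neq0 : forall i, alpha i != 0)
    (alpha_indep : F2_independent alpha)
    (beta_neq0 : forall j, beta j != 0)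
    (alpha_beta : forall i j, abs_trace (alpha i * beta j) = (i == j)%:R) :
  ((16 < #|F|)%N ->
     elation_KM_arc (#|F| %/ 8) (arc_A alpha beta) (lineX0 F) /\
     nucleus (#|F| %/ 8) (arc_A alpha beta) (point001 F)) /\
  (#|F| = 16%N -> elation_hyperoval (arc_A alpha beta) (lineX0 F)).
Proof.
have KM := arc_KM_arc h_ge4 cardF alpha_indep alpha_beta.
split=> [F_gt16|F16].
  have t_gt2 : (2 < #|F| %/ 8)%N.
    (* From q > 16 follows h >= 5, so q >= 32, which exceeds the required 3 * 8. *)
    move: F_gt16; rewrite cardF -[16%N]/(2 ^ 4)%N ltn_exp2l // => h_gt4.
    by rewrite leq_divRL // (leq_trans _ (@leq_pexp2l 2 5 h isT h_gt4)).
  split; last exact: (arc_nucleus cardF alpha_indep alpha_beta t_gt2).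
  split=> // L Lt LX0 P Q.
  exact: (arc_transitive cardF alpha_indep alpha_beta t_gt2 Lt LX0).
split; first by move: KM; rewrite F16.
(* For q = 16 the set [S] has two elements, so one of them is nonzero. *)
have [s sS s0] : exists2 s, s \in set_S alpha & s != 0.
  have := card_S cardF alpha_beta; rewrite F16 => card2.
  have /card_gt1P[x [y [xS yS xy]]] : (1 < #|set_S alpha|)%N by rewrite card2.
  have [x0|] := eqVneq x 0; last by exists x.
  by exists y; rewrite // -x0 eq_sym.
exists (shear_perm s); split.
- exact: shear_elation.
(* The shear by [s] moves (1,0,0) to (1,0,s), so it is trivial only for s = 0. *)
- apply: contra s0 => /eqP g1; have := shear_perm_pt1 s 0 0.
  by rewrite g1 perm1 => /pt1_inj[_]; rewrite add0r => ->.
exact: (shear_stabilises beta cardF sS).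
Qed.
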